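(* For every formula $A$, the following formulae are derivable in $\mathbf{GMALL}$: (1) $\neg\boxdot\bot$; (2) $\Diamond\top$; (3) $\neg\boxdot(A\land\neg A)$; (4) $\Diamond(A\lor\neg A)$.
   Context: Formulae are built from propositional variables and constants $0,1,\bot,\top$ using the connectives $\otimes$, $\oplus$ (multiplicative disjunction, ''par''), $\land$, $\lor$ (additive conjunction and disjunction), $\neg$, $\to$. A sequent $\Gamma\Rightarrow\Delta$ is a pair of finite multisets of formulae; commas denote multiset union. A formula $C$ is derivable in a calculus if the sequent ${}\Rightarrow C$ is derivable. The calculus $\mathbf{GMALL}$ for Multiplicative Additive Linear Logic has the following rules (no cut, weakening or contraction). Axioms: $A\Rightarrow A$; $0\Rightarrow{}$; ${}\Rightarrow 1$; $\bot,\Gamma\Rightarrow\Delta$; $\Gamma\Rightarrow\Delta,\top$. $(R0)$ from $\Gamma\Rightarrow\Delta$ infer $\Gamma\Rightarrow\Delta,0$. $(L1)$ from $\Gamma\Rightarrow\Delta$ infer $1,\Gamma\Rightarrow\Delta$. $(L\otimes)$ from $\Gamma,A,B\Rightarrow\Delta$ infer $A\otimes B,\Gamma\Rightarrow\Delta$. $(R\otimes)$ from $\Gamma\Rightarrow\Delta,A$ and $\Gamma'\Rightarrow\Delta',B$ infer $\Gamma,\Gamma'\Rightarrow\Delta,\Delta',A\otimes B$. $(L\oplus)$ from $A,\Gamma\Rightarrow\Delta$ and $B,\Gamma'\Rightarrow\Delta'$ infer $A\oplus B,\Gamma,\Gamma'\Rightarrow\Delta,\Delta'$. $(R\oplus)$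 from $\Gamma\Rightarrow\Delta,A,B$ infer $\Gamma\Rightarrow\Delta,A\oplus B$. $(L\land_1),(L\land_2)$ from $A,\Gamma\Rightarrow\Delta$, respectively from $B,\Gamma\Rightarrow\Delta$, infer $A\land B,\Gamma\Rightarrow\Delta$. $(R\land)$ from $\Gamma\Rightarrow\Delta,A$ and $\Gamma\Rightarrow\Delta,B$ infer $\Gamma\Rightarrow\Delta,A\land B$. $(L\lor)$ from $A,\Gamma\Rightarrow\Delta$ and $B,\Gamma\Rightarrow\Delta$ infer $A\lor B,\Gamma\Rightarrow\Delta$. $(R\lor_1),(R\lor_2)$ from $\Gamma\Rightarrow\Delta,A$, respectively from $\Gamma\Rightarrow\Delta,B$, infer $\Gamma\Rightarrow\Delta,A\lor B$. $(L\neg)$ from $\Gamma\Rightarrow\Delta,A$ infer $\neg A,\Gamma\Rightarrow\Delta$. $(R\neg)$ from $A,\Gamma\Rightarrow\Delta$ infer $\Gamma\Rightarrow\Delta,\neg A$. $(L\to)$ from $\Gamma\Rightarrow\Delta,A$ and $B,\Gamma'\Rightarrow\Delta'$ infer $A\to B,\Gamma,\Gamma'\Rightarrow\Delta,\Delta'$. $(R\to)$ from $A,\Gamma\Rightarrow\Delta,B$ infer $\Gamma\Rightarrow\Delta,A\to B$. The Tarskian modalities are the abbreviations $\Diamond A := \neg A\to A$ and $\boxdot A := \neg\Diamond\neg A$. *)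

(* Defs.v *)
From HB Require Import structures.
From mathcomp Require Import all_boot.
From mathcomp Require Import finmap multiset.

Set Implicit Arguments.
Unset Strict Implicit.
Unset Printing Implicit Defensive.

Local Open Scope mset_scope.

(* [FZero] and [FOne] are the multiplicative units (0 is the unit of the
   multiplicative disjunction, 1 that of the multiplicative conjunction);
   [FBot] and [FTop] are the additive ones. *)
Inductive formula : Type :=
| FVar of nat
| FZero
| FOne
| FBot
| FTop
| FTensor of formula & formula
| FPar of formula & formula
| FAnd of formula & formula
| FOr of formula & formula
| FNeg of formula
| FImp of formula & formula.

(* An encoding into generic trees; it only serves to equip [formula] with the
   [choiceType] structure required by [{mset formula}]. *)
Fixpoint tree_of_formula (A : formula) : GenTree.tree nat :=
  match A with
  | FVar n => GenTree.Leaf n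
  | FZero => GenTree.Node 0 [::]
  | FOne => GenTree.Node 1 [::]
  | FBot => GenTree.Node 2 [::]
  | FTop => GenTree.Node 3 [::]
  | FTensor B C => GenTree.Node 4 [:: tree_of_formula B; tree_of_formula C]
  | FPar B C => GenTree.Node 5 [:: tree_of_formula B; tree_of_formula C]
  | FAnd B C => GenTree.Node 6 [:: tree_of_formula B; tree_of_formula C]
  | FOr B C => GenTree.Node 7 [:: tree_of_formula B; tree_of_formula C]
  | FNeg B => GenTree.Node 8 [:: tree_of_formula B]
  | FImp B C => GenTree.Node 9 [:: tree_of_formula B; tree_of_formula C]
  end.

Fixpoint formula_of_tree (t : GenTree.tree nat) : formula :=
  match t with
  | GenTree.Leaf n => FVar n
  | GenTree.Node 0 _ => FZero
  | GenTree.Node 1 _ => FOne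
  | GenTree.Node 2 _ => FBot
  | GenTree.Node 3 _ => FTop
  | GenTree.Node 4 [:: b; c] => FTensor (formula_of_tree b) (formula_of_tree c)
  | GenTree.Node 5 [:: b; c] => FPar (formula_of_tree b) (formula_of_tree c)
  | GenTree.Node 6 [:: b; c] => FAnd (formula_of_tree b) (formula_of_tree c)
  | GenTree.Node 7 [:: b; c] => FOr (formula_of_tree b) (formula_of_tree c)
  | GenTree.Node 8 [:: b] => FNeg (formula_of_tree b)
  | GenTree.Node 9 [:: b; c] => FImp (formula_of_tree b) (formula_of_tree c)
  | _ => FZero
  end.

Lemma tree_of_formulaK : cancel tree_of_formula formula_of_tree.
Proof. by elim=> //= [B -> C ->|B -> C ->|B -> C ->|B -> C ->|B ->|B -> C ->]. Qed.

HB.instance Definition _ := Countable.copy formula (can_type tree_of_formulaK).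

Declare Scope formula_scope.
Delimit Scope formula_scope with F.
Bind Scope formula_scope with formula.

Notation "⊥" := FBot : formula_scope.
Notation "⊤" := FTop : formula_scope.
Notation "¬ A" := (FNeg A)
  (at level 35, right associativity, format "¬ A") : formula_scope.
Notation "A ⊗ B" := (FTensor A B) (at level 40, left associativity) : formula_scope.
Notation "A ⊕ B" := (FPar A B) (at level 50, left associativity) : formula_scope.
Notation "A ∧ B" := (FAnd A B) (at level 80, right associativity) : formula_scope.
Notation "A ∨ B" := (FOr A B) (at level 85, right associativity) : formula_scope.
Notation "A → B" := (FImp A B)
  (at level 99, B at level 200, right associativity) : formula_scope.

Definition Diamond (A : formula) : formula := (¬ A → A)%F.

Notation "◇ A" := (Diamond A)
  (at level 35, right associativity, format "◇ A") : formula_scope.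

Definition Boxdot (A : formula) : formula := (¬ ◇ ¬ A)%F.

Notation "⊡ A" := (Boxdot A)
  (at level 35, right associativity, format "⊡ A") : formula_scope.

(* Multisets are compared extensionally ([msetP]), so no exchange rule is
   needed.  [`+`] is the multiset sum, which adds multiplicities; the multiset
   operation [`|`] takes their maximum. *)
Reserved Notation "G ⇒ D" (at level 70, no associativity).

Implicit Types (A B C : formula) (G D : {mset formula}).

Inductive GMALL : {mset formula} -> {mset formula} -> Prop :=
| Ax A : [mset A] ⇒ [mset A]
| L0 : [mset FZero] ⇒ mset0
| R1 : mset0 ⇒ [mset FOne]
| Lbot G D : [mset FBot] `+` G ⇒ D
| Rtop G D : G ⇒ D `+` [mset FTop]
| R0 G D : G ⇒ D -> G ⇒ D `+` [mset FZero]
| L1 G D : G ⇒ D -> [mset FOne] `+` G ⇒ D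
| Ltensor A B G D :
    G `+` [mset A; B] ⇒ D -> [mset (A ⊗ B)%F] `+` G ⇒ D
| Rtensor A B G G' D D' :
    G ⇒ D `+` [mset A] -> G' ⇒ D' `+` [mset B] ->
    G `+` G' ⇒ D `+` D' `+` [mset (A ⊗ B)%F]
| Lpar A B G G' D D' :
    [mset A] `+` G ⇒ D -> [mset B] `+` G' ⇒ D' ->
    [mset (A ⊕ B)%F] `+` G `+` G' ⇒ D `+` D'
| Rpar A B G D :
    G ⇒ D `+` [mset A; B] -> G ⇒ D `+` [mset (A ⊕ B)%F]
| Land1 A B G D :
    [mset A] `+` G ⇒ D -> [mset (A ∧ B)%F] `+` G ⇒ D
| Land2 A B G D :
    [mset B] `+` G ⇒ D -> [mset (A ∧ B)%F] `+` G ⇒ D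
| Rand A B G D :
    G ⇒ D `+` [mset A] -> G ⇒ D `+` [mset B] -> G ⇒ D `+` [mset (A ∧ B)%F]
| Lor A B G D :
    [mset A] `+` G ⇒ D -> [mset B] `+` G ⇒ D -> [mset (A ∨ B)%F] `+` G ⇒ D
| Ror1 A B G D :
    G ⇒ D `+` [mset A] -> G ⇒ D `+` [mset (A ∨ B)%F]
| Ror2 A B G D :
    G ⇒ D `+` [mset B] -> G ⇒ D `+` [mset (A ∨ B)%F]
| Lneg A G D :
    G ⇒ D `+` [mset A] -> [mset (¬ A)%F] `+` G ⇒ D
| Rneg A G D :
    [mset A] `+` G ⇒ D -> G ⇒ D `+` [mset (¬ A)%F]
| Limp A B G G' D D' :
    G ⇒ D `+` [mset A] -> [mset B] `+` G' ⇒ D' ->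
    [mset (A → B)%F] `+` G `+` G' ⇒ D `+` D'
| Rimp A B G D :
    [mset A] `+` G ⇒ D `+` [mset B] -> G ⇒ D `+` [mset (A → B)%F]
where "G ⇒ D" := (GMALL G D).

Definition derivable (C : formula) : Prop := GMALL mset0 [mset C].

(* Main.v *)
Require Import Defs.
From mathcomp Require Import all_boot finmap multiset.

(** The hypothesis of [◇ B = ¬ B → B] is an occurrence of [¬ B] on the left, which
    moves to the right as a second copy of [B].  Hence [◇ B] is derivable as soon
    as [⇒ B, B] is ([derivable_Diamond]): the modality supplies the contraction
    on the right that the calculus lacks.  Dually [¬ ⊡ B = ¬ ¬ ◇ ¬ B] is derivable
    as soon as [B, B ⇒] is ([derivable_NegBoxdot]).

    With two copies available, [⇒ ⊤, ⊤] and [⊥, ⊥ ⇒] are axioms, and the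
    classical arguments for excluded middle and non-contradiction go through:
    one copy of [A ∨ ¬ A] (of [A ∧ ¬ A]) provides [A], the other one [¬ A]. *)

Local Open Scope mset_scope.

(** Read upwards: (R→) puts [¬ B] on the left next to the succedent [B], and (L¬)
    turns it into the other copy of [B]. *)
Lemma derivable_Diamond (B : formula) :
  GMALL mset0 ([mset B] `+` [mset B]) -> derivable (◇ B).
Proof.
move=> BB; rewrite /derivable -[[mset _]]mset0D.
by apply: Rimp; rewrite mset0D; apply: Lneg.
Qed.

(** The outer double negation is inert, and the two copies of [¬ B] on the right
    that [◇ ¬ B] asks for come from two copies of [B] on the left. *)
Lemma derivable_NegBoxdot (B : formula) :
  GMALL ([mset B] `+` [mset B]) mset0 -> derivable (¬ ⊡ B).
Proof.
move=> BB; rewrite /derivable -[[mset _]]mset0D.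
apply: Rneg; apply: Lneg; rewrite mset0D.
apply: derivable_Diamond; apply: Rneg; rewrite -[[mset (¬ B)%F]]mset0D.
by apply: Rneg; rewrite msetD0.
Qed.

Theorem mainTheorem2 (A : formula) :
  derivable (¬ ⊡ ⊥) /\
  derivable (◇ ⊤) /\
  derivable (¬ ⊡ (A ∧ ¬ A)) /\
  derivable (◇ (A ∨ ¬ A)).
Proof.
split; [|split; [|split]].
- by apply: derivable_NegBoxdot; apply: Lbot.
- by apply: derivable_Diamond; apply: Rtop.
- apply: derivable_NegBoxdot; apply: Land2; apply: Lneg.
  rewrite mset0D -[[mset (A ∧ ¬ A)%F]]msetD0.
  by apply: Land1; rewrite msetD0; apply: Ax.
- apply: derivable_Diamond; apply: Ror2; apply: Rneg; rewrite msetD0.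
  rewrite -[[mset (A ∨ ¬ A)%F]]mset0D.
  by apply: Ror1; rewrite mset0D; apply: Ax.
Qed.
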